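(* Consider a move-effect system with state set $\mathcal{S}$, action set $\mathcal{A}=\mathcal{A}_M\times\mathcal{A}_E$ and transition function $T$ such that, for all times $t>0$, the next effector configuration $\theta_{t+1}$ is conditionally independent of the state $s_t$ given $crop(I_t,a_m(t))$. Let $\langle f,\{g_s\mid s\in\mathcal{S}\}\rangle$ be a deictic image mapping and let $R':\mathcal{S}'\times\mathcal{A}'\to\mathbb{R}$ be an abstract reward function. Then there exist a reward function $R$ and an abstract transition function $T'$ for which $\langle f,\{g_s\mid s\in\mathcal{S}\}\rangle$ is an MDP homomorphism from $\mathcal{M}=\langle\mathcal{S},\mathcal{A},T,R\rangle$ to $\mathcal{M}'=\langle\mathcal{S}',\mathcal{A}',T',R'\rangle$.
   Context: **MDP.** A Markov decision process is a tuple $\langle\mathcal{S},\mathcal{A},T,R\rangle$ with a set of states $\mathcal{S}$, a discrete set of actions $\mathcal{A}$, a transition probability function $T:\mathcal{S}\times\mathcal{A}\times\mathcal{S}\to[0,1]$, where $T(s_t,a_t,s_{t+1})$ is the probability of transitioning to $s_{t+1}$ when $a_t$ is taken from $s_t$, and a function $R:\mathcal{S}\times\mathcal{A}\to\mathbb{R}$ giving the expected reward of executing action $a$ from state $s$. **Move-effect system.** A discrete-time system comprised of a set of effectors mounted on a fully actuated mobile base that operates in a Euclidean space of dimension $d\in\{2,3\}$. On every time step $t$ the system perceives an image or signed distance function $I_t\in\mathcal{I}=[0\dots 2^{16}]^{|grid|}$, where $grid\subset\mathbb{R}^d$ is a finite set of points (pixel or voxel positions), and has access to the configuration of its effectors $\theta_t\in\Theta$.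 It then executes an action $a_t=(a_m(t),a_e(t))\in\mathcal{A}=\mathcal{A}_M\times\mathcal{A}_E$: a collision-free motion of the base to $a_m(t)\in\mathcal{A}_M\subset SE(d)$, followed by a motion $a_e(t)\in\mathcal{A}_E$ of the effectors. **States.** A state is a history of the $k$ most recent observations and the actions between them, $$s_t=\langle I_t^{1-k},\theta_t^{1-k},a_t^{1-k},\dots,I_t^{-1},\theta_t^{-1},a_t^{-1},I_t,\theta_t\rangle,$$ where $I_t,\theta_t$ are the current values and $I_t^{-i},\theta_t^{-i},a_t^{-i}$ are the respective variables as they were $i$ time steps before $t$. Thus $\mathcal{S}=\mathcal{I}^k\times\Theta^k\times\mathcal{A}^{k-1}$. The value $k$ is taken sufficiently large that the system is Markov. **Deictic image mapping.** For $I\in\mathcal{I}$ and $a_m\in\mathcal{A}_M$, $crop(I,a_m)\in\mathcal{I}'=[0\dots2^{16}]^{|\overline{grid}|}$ denotes a cropped region of $I$ centered on $a_m$ and aligned with the basis axes of $a_m$, defined over positions $\overline{grid}\subset grid$ that are assumed to correspond to a closed region of $I$. The abstract action set is $\mathcal{A}'=\mathcal{I}'\times\mathcal{A}_E$, and the action mapping $g_{s_t}:\mathcal{A}\to\mathcal{A}'$ is $$g_{s_t}(a_t)=\langle crop(I_t,a_m(t)),\,a_e(t)\rangle,$$ where $I_t$ is the current image in $s_t$. The abstract state set is $\mathcal{S}'=\mathcal{I}'^{\,k-1}\times\mathcal{A}_E^{k-1}\times\Theta$, and the state mapping $f=f_k:\mathcal{S}\to\mathcal{S}'$ is $$f_k(s_t)=\langle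 crop(I_t^{1-k},a_m^{1-k}(t)),a_e^{1-k}(t),\dots,crop(I_t^{-1},a_m^{-1}(t)),a_e^{-1}(t),\theta_t\rangle,$$ where $a_t^{-i}=(a_m^{-i}(t),a_e^{-i}(t))$; that is, the current effector configuration paired with the history of the $k-1$ most recently executed abstract actions. The deictic image mapping is the tuple $\langle f,\{g_s\mid s\in\mathcal{S}\}\rangle$. **MDP homomorphism.** An MDP homomorphism from an MDP $\mathcal{M}=\langle\mathcal{S},\mathcal{A},T,R\rangle$ onto an MDP $\mathcal{M}'=\langle\mathcal{S}',\mathcal{A}',T',R'\rangle$ is a tuple of mappings $\langle f,\{g_s\mid s\in\mathcal{S}\}\rangle$, where $f:\mathcal{S}\to\mathcal{S}'$ is a state mapping and $g_s:\mathcal{A}\to\mathcal{A}'$, $s\in\mathcal{S}$, is a set of action mappings, such that for all $s\in\mathcal{S}$, $a\in\mathcal{A}$, $s'\in\mathcal{S}'$: $$T'(f(s),g_s(a),s')=\sum_{\bar s\in\mathcal{S}:\,f(\bar s)=s'}T(s,a,\bar s),\qquad R'(f(s),g_s(a))=R(s,a).$$ *)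

(* Defs.v *)
From HB Require Import structures.
From mathcomp Require Import all_boot all_order all_algebra finmap.
From mathcomp Require Import all_classical all_reals all_analysis.
Set Implicit Arguments.
Unset Strict Implicit.
Unset Printing Implicit Defensive.
Import Order.TTheory GRing.Theory Num.Theory.
Import numFieldNormedType.Exports.
Local Open Scope classical_set_scope.
Local Open Scope ring_scope.

(** * Discrete laws, as probability mass functions on arbitrary sets *)

Section DiscreteLaws.
Variable R : realType.

Definition prob (W : choiceType) (P : W -> R) (E : set W) : \bar R :=
  \esum_(w in E) (P w)%:E.

Definition is_pmf (W : choiceType) (P : W -> R) : Prop :=
  (forall w, 0 <= P w) /\ prob P [set: W] = 1%E.

(** [X] and [Y] are conditionally independent given [Z].  The denominators of
    P(X=x, Y=y | Z=z) = P(X=x | Z=z) P(Y=y | Z=z) are cleared, so that values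
    [z] of probability zero impose nothing. *)
Definition cond_indep (W : choiceType) (P : W -> R) (A B C : Type)
    (X : W -> A) (Y : W -> B) (Z : W -> C) : Prop :=
  forall x y z,
    (prob P [set w | [/\ X w = x, Y w = y & Z w = z]] *
       prob P [set w | Z w = z] =
     prob P [set w | X w = x /\ Z w = z] *
       prob P [set w | Y w = y /\ Z w = z])%E.

End DiscreteLaws.

(** * Markov decision processes and their homomorphisms *)

Section MDP.
Variable R : realType.

(** The bound T(s, a, s') <= 1 follows from [transition_pmf]. *)
Record transition (S A : choiceType) := Transition {
  transition_fun :> S -> A -> S -> R;
  transition_pmf : forall s a, is_pmf (transition_fun s a)
}.

(** A discrete set of actions is read as a countable one. *)
Record mdp := MDP {
  mdp_state : choiceType;
  mdp_action : countType;
  mdp_trans : transition mdp_state mdp_action;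
  mdp_reward : mdp_state -> mdp_action -> R
}.

Definition mdp_homomorphism (M M' : mdp) (f : mdp_state M -> mdp_state M')
    (g : mdp_state M -> mdp_action M -> mdp_action M') : Prop :=
  forall (s : mdp_state M) (a : mdp_action M) (s' : mdp_state M'),
    (@mdp_trans M' (f s) (g s a) s')%:E
      = \esum_(t in [set t | f t = s']) (@mdp_trans M s a t)%:E
    /\ @mdp_reward M' (f s) (g s a) = @mdp_reward M s a.

End MDP.

(** * Move-effect systems *)

(** Elements of SE(d), acting on R^d by [p |-> se_rot *m p + se_vec]. *)
Record SE (R : realType) (d : nat) := MkSE {
  se_rot : 'M[R]_d;
  se_vec : 'cV[R]_d;
  se_orth : se_rot *m se_rot^T = 1%:M;
  se_det : \det se_rot = 1
}.

Definition se_act (R : realType) (d : nat) (m : SE R d) (p : 'cV[R]_d) :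
  'cV[R]_d := se_rot m *m p + se_vec m.

(** Images over a finite set of positions, with values in {0, ..., 2^16}. *)
Notation image_on G := {ffun G -> 'I_(2 ^ 16).+1} (only parsing).

(** The sets a move-effect system is built on.  The countable subset of SE(d)
    of base motions is given as a countable type embedded in SE(d).
    [me_past] is k - 1, the number of past time steps recorded in a state. *)
Record me_spaces (R : realType) := MeSpaces {
  me_dim : nat;
  me_dimP : me_dim = 2%N \/ me_dim = 3%N;
  me_grid : {fset 'cV[R]_me_dim};
  me_conf : choiceType;
  me_base : countType;
  me_pose : me_base -> SE R me_dim;
  me_pose_inj : injective me_pose;
  me_eff : countType;
  me_past : nat
}.

Section MoveEffect.
Variables (R : realType) (D : me_spaces R).

Definition me_image : finType := image_on (me_grid D).

Definition me_action : countType := (me_base D * me_eff D)%type.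

(** S = I^k x Theta^k x A^(k-1), indexed by age: the entry of index [i] of the
    first two components is i time steps old, whereas the entry of index [j] of
    the third one is j + 1 time steps old. *)
Definition me_state : choiceType :=
  ({ffun 'I_(me_past D).+1 -> me_image} *
   {ffun 'I_(me_past D).+1 -> me_conf D} *
   {ffun 'I_(me_past D) -> me_action})%type.

Definition images (s : me_state) : {ffun 'I_(me_past D).+1 -> me_image} :=
  s.1.1.
Definition confs (s : me_state) : {ffun 'I_(me_past D).+1 -> me_conf D} :=
  s.1.2.
Definition actions (s : me_state) : {ffun 'I_(me_past D) -> me_action} := s.2.

Definition cur_image (s : me_state) : me_image := images s ord0.
Definition cur_conf (s : me_state) : me_conf D := confs s ord0.

(** [s'] is a history that prolongs [s] by the action [a] and an arbitrary new
    observation: every entry of [s] ages by one and the oldest ones are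
    dropped. *)
Definition successor (s : me_state) (a : me_action) (s' : me_state) : Prop :=
  [/\ forall i j : 'I_(me_past D).+1, j = i.+1 :> nat ->
        images s' j = images s i /\ confs s' j = confs s i,
      forall j : 'I_(me_past D), j = 0%N :> nat -> actions s' j = a
    & forall i j : 'I_(me_past D), j = i.+1 :> nat ->
        actions s' j = actions s i].

Definition history_transition (T : transition R me_state me_action) : Prop :=
  forall s a s', T s a s' != 0 -> successor s a s'.

(** ** Deictic image mappings *)

(** The positions of the cropped images: those of the grid lying in the region
    [K] of R^d. *)
Definition crop_grid (K : set 'cV[R]_(me_dim D)) : {fset 'cV[R]_(me_dim D)} :=
  [fset p in me_grid D | p \in K]%fset.

Definition crop_center (K : set 'cV[R]_(me_dim D)) : 'cV[R]_(me_dim D) :=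
  (#|` crop_grid K|%:R)^-1 *: \sum_(p : crop_grid K) val p.

Definition crop_image (K : set 'cV[R]_(me_dim D)) : finType :=
  image_on (crop_grid K).

(** The pixel [p] of the crop at the pose [m] is the pixel of the image located
    at the point whose coordinates in the frame [m] are [p - crop_center K]:
    the crop is centered on the origin of [m] and aligned with its axes.  When
    this point is not on the grid (it falls between the pixels or outside the
    image), the value is left to the interpolation and padding of [crop]. *)
Definition is_crop (K : set 'cV[R]_(me_dim D))
    (crop : me_image -> me_base D -> crop_image K) : Prop :=
  forall (I : me_image) (m : me_base D) (p : crop_grid K) (q : me_grid D),
    val q = se_act (me_pose m) (val p - crop_center K) ->
    crop I m p = I q.

Section Deictic.
Variables (K : set 'cV[R]_(me_dim D)).
Variable crop : me_image -> me_base D -> crop_image K.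

Definition abs_action : countType := (crop_image K * me_eff D)%type.

Definition abs_state : choiceType :=
  ({ffun 'I_(me_past D) -> crop_image K} *
   {ffun 'I_(me_past D) -> me_eff D} * me_conf D)%type.

Definition deictic_action (s : me_state) (a : me_action) : abs_action :=
  (crop (cur_image s) a.1, a.2).

(** [lift ord0 j] has value [j + 1]: the image and the action that are paired
    belong to the same time step. *)
Definition deictic_state (s : me_state) : abs_state :=
  ([ffun j : 'I_(me_past D) =>
      crop (images s (lift ord0 j)) (actions s j).1],
   [ffun j : 'I_(me_past D) => (actions s j).2],
   cur_conf s).

(** ** Conditional independence of the next effector configuration *)

(** Joint law of (s_t, a_m(t), s_{t+1}) when (s_t, a_m(t)) has law [mu] and the
    effectors execute [e]. *)
Definition step_law (T : transition R me_state me_action) (e : me_eff D)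
    (mu : me_state * me_base D -> R) (w : me_state * me_base D * me_state) : R :=
  mu w.1 * T w.1.1 (w.1.2, e) w.2.

(** theta_{t+1} is conditionally independent of s_t given crop(I_t, a_m(t)).
    A decision process fixes neither an initial law nor a policy, hence the
    quantification over all laws of (s_t, a_m(t)); the motion [e] of the
    effectors is a control, on which the law of theta_{t+1} may depend. *)
Definition next_conf_cond_indep (T : transition R me_state me_action) : Prop :=
  forall (e : me_eff D) (mu : me_state * me_base D -> R), is_pmf mu ->
    cond_indep (step_law T e mu)
      (fun w => cur_conf w.2)
      (fun w => w.1.1)
      (fun w => crop (cur_image w.1.1) w.1.2).

End Deictic.
End MoveEffect.

(* Main.v *)
(** Each transition law [T s a] is pushed forward along [f]; the abstract
    transition is well defined because the result depends on [f s] and [g s a]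
    only.  The past part of the next abstract state is a function of [f s] and
    [g s a], since a successor history only shifts.  For the effector
    configuration, conditional independence is applied to the uniform law on
    two pairs (s1, m1), (s2, m2) with the same crop and [s1 != s2]: it says
    that the next configuration has the same law from both. *)

Require Import Defs.
From HB Require Import structures.
From mathcomp Require Import all_boot all_order all_algebra finmap.
From mathcomp Require Import all_classical all_reals all_analysis.
Set Implicit Arguments.
Unset Strict Implicit.
Unset Printing Implicit Defensive.
Import Order.TTheory GRing.Theory Num.Theory.
Import numFieldNormedType.Exports.
Local Open Scope classical_set_scope.
Local Open Scope ring_scope.

(** * Pushforwards of discrete laws and uniform laws on two points *)

Section DiscreteLawTheory.
Variable R : realType.

Lemma prob_ge0 (W : choiceType) (P : W -> R) (E : set W) :
  is_pmf P -> (0 <= prob P E)%E.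
Proof. by move=> [P0 _]; apply: esum_ge0 => w _; rewrite lee_fin. Qed.

Lemma prob_le1 (W : choiceType) (P : W -> R) (E : set W) :
  is_pmf P -> (prob P E <= 1)%E.
Proof.
move=> [P0 <-]; rewrite /prob esum_mkcond; apply: le_esum => w _.
by case: ifP => _; rewrite ?lee_fin.
Qed.

Lemma prob_fin_num (W : choiceType) (P : W -> R) (E : set W) :
  is_pmf P -> prob P E \is a fin_num.
Proof.
move=> Ppmf; rewrite ge0_fin_numE ?prob_ge0//.
by rewrite (le_lt_trans (prob_le1 E Ppmf))// ltry.
Qed.

Lemma eq_prob_support (W : choiceType) (P : W -> R) (E F : set W) :
  (forall w, P w != 0 -> E w <-> F w) -> prob P E = prob P F.
Proof.
move=> EF; rewrite /prob esum_mkcond [RHS]esum_mkcond.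
apply: eq_esum => w _; have [->|/EF {}EF] := eqVneq (P w) 0.
  by rewrite !if_same.
by congr (if _ then _ else _); apply/idP/idP; rewrite !inE => /EF.
Qed.

Lemma is_pmf_dirac (W : choiceType) (w0 : W) :
  is_pmf (fun w => (w == w0)%:R : R).
Proof.
split=> [w|]; first exact: ler0n.
rewrite (@eq_prob_support _ _ _ [set w0]).
  by rewrite /prob esum_set1 ?eqxx.
by move=> w; have [->|] := eqVneq w w0; rewrite ?eqxx.
Qed.

(** When [P] is a pmf, fibre masses are at most 1, so [fine] never falls back on its default
    value. *)
Definition pushforward_pmf (W U : choiceType) (f : W -> U) (P : W -> R)
    (u : U) : R :=
  fine (prob P [set w | f w = u]).

Lemma pushforward_pmfE (W U : choiceType) (f : W -> U) (P : W -> R) (u : U) :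
  is_pmf P -> (pushforward_pmf f P u)%:E = prob P [set w | f w = u].
Proof. by move=> Ppmf; rewrite fineK ?prob_fin_num. Qed.

Lemma is_pmf_pushforward (W U : choiceType) (f : W -> U) (P : W -> R) :
  is_pmf P -> is_pmf (pushforward_pmf f P).
Proof.
move=> Ppmf; split=> [u|]; first by rewrite fine_ge0 ?prob_ge0.
rewrite /prob; under eq_esum => u _ do rewrite pushforward_pmfE//.
rewrite /prob esum_esum => [|u w _ _]; last by rewrite lee_fin Ppmf.1.
(* The double sum runs over the graph of [f], which [w |-> (f w, w)] parametrizes bijectively. *)
rewrite -[RHS]Ppmf.2 (@reindex_esum _ _ _ setT _ (fun w => (f w, w))) //.
split=> [w _ //|w1 w2 _ _ []//|[u w] [_ /= <-]].
by exists w.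
Qed.

Lemma esum_two_fibers (U V : choiceType) (p1 p2 : U) (F : U * V -> \bar R)
    (E : set (U * V)) : p1 != p2 -> (forall w, (0 <= F w)%E) ->
  (forall w, w.1 != p1 -> w.1 != p2 -> F w = 0%E) ->
  (\esum_(w in E) F w =
     \esum_(t in [set t | E (p1, t)]) F (p1, t) +
     \esum_(t in [set t | E (p2, t)]) F (p2, t))%E.
Proof.
move=> p12 F0 Fsupp.
rewrite (esumID [set w | w.1 = p1]) //; congr (_ + _)%E.
  rewrite -(esum_image [set t | E (p1, t)] (pair p1) F); last by move=> ? ? _ _ [].
  congr esum; apply/seteqP; split=> [[u t] /= [Et up]|_ [t Et <-]] //.
  by subst u; exists t.
rewrite (esumID [set w | w.1 = p2]) // [X in (_ + X)%E]esum1 ?adde0; last first.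
  by move=> w [[_ /= /eqP w1] /eqP w2]; exact: Fsupp.
rewrite -(esum_image [set t | E (p2, t)] (pair p2) F); last by move=> ? ? _ _ [].
congr esum; apply/seteqP; split=> [[u t] /= [[Et _] up]|_ [t Et <-]] //.
  by subst u; exists t.
by split=> //; split=> //= /eqP; rewrite eq_sym (negbTE p12).
Qed.

(** When [p1 = p2] the total mass is only 1/2, whence the condition [p1 != p2] in
    [is_pmf_two_point]. *)
Definition two_point_pmf (U : choiceType) (p1 p2 p : U) : R :=
  2^-1 *+ ((p == p1) || (p == p2)).

Lemma two_point_pmf_ge0 (U : choiceType) (p1 p2 p : U) :
  0 <= two_point_pmf p1 p2 p.
Proof. by rewrite mulrn_wge0 ?invr_ge0. Qed.

Lemma is_pmf_two_point (U : choiceType) (p1 p2 : U) :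
  p1 != p2 -> is_pmf (two_point_pmf p1 p2).
Proof.
move=> p12; split=> [p|]; first exact: two_point_pmf_ge0.
have nonneg p : (0 <= (two_point_pmf p1 p2 p)%:E)%E.
  by rewrite lee_fin two_point_pmf_ge0.
rewrite (@eq_prob_support _ _ _ [set p1; p2]).
  rewrite /prob (esumID [set p1]) //.
  rewrite (_ : _ `&` [set p1] = [set p1]); last first.
    by apply/seteqP; split=> [? []//|? ->]; split=> //; left.
  rewrite (_ : _ `&` ~` [set p1] = [set p2]); last first.
    apply/seteqP; split=> [? [[]]//|? ->]; split; first by right.
    by move=> /= p21; rewrite p21 eqxx in p12.
  rewrite !esum_set1 // /two_point_pmf !eqxx orbT -EFinD.
  by rewrite !mulr1n -[2^-1]mul1r -splitr.
move=> p; rewrite /two_point_pmf; case: (p =P p1) => [->|_].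
  by split=> // _; left.
by case: (p =P p2) => [->|_] /=; [split=> // _; right|rewrite mulr0n eqxx].
Qed.

End DiscreteLawTheory.

(** * Transition laws seen through the deictic image mapping *)

Section DeicticHomomorphism.
Variables (R : realType) (D : me_spaces R).
Variable T : transition R (me_state D) (me_action D).
Variable K : set 'cV[R]_(me_dim D).
Variable crop : me_image D -> me_base D -> crop_image K.

Local Notation f := (deictic_state crop).
Local Notation g := (deictic_action crop).

(** The newest entry of the abstract past is the abstract action just executed, and every other
    entry is copied from the previous abstract state. The current configuration is left out because
    it is random. *)
Lemma successor_deictic_state s1 s2 a1 a2 t1 t2 :
  f s1 = f s2 -> g s1 a1 = g s2 a2 ->
  successor s1 a1 t1 -> successor s2 a2 t2 -> (f t1).1 = (f t2).1.
Proof.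
move=> [] /ffunP crops /ffunP effs _ [crop0 eff0].
move=> [obs1 act01 act1] [obs2 act02 act2].
congr (_, _); apply/ffunP => j; rewrite !ffunE.
  (* Entry [j] of the abstract past uses the image of age [j + 1]. For [j = 0] this is the current
     image of the predecessor, which was cropped by [g]; for [j > 0] it is the image in entry
     [j - 1] of the predecessor's abstract past. *)
  case: (posnP j) => [j0|j_gt0].
    have jE : lift ord0 j = (ord0 : 'I_(me_past D).+1).+1 :> nat.
      by rewrite lift0 j0.
    rewrite (act01 _ j0) (act02 _ j0) (obs1 _ _ jE).1 (obs2 _ _ jE).1.
    exact: crop0.
  have ltj : (j.-1 < me_past D)%N by rewrite (leq_ltn_trans (leq_pred j)).
  have jE : j = (Ordinal ltj).+1 :> nat by rewrite /= prednK.
  have ljE : lift ord0 j = (lift ord0 (Ordinal ltj)).+1 :> nat.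
    by rewrite !lift0 -jE.
  rewrite (act1 _ _ jE) (act2 _ _ jE) (obs1 _ _ ljE).1 (obs2 _ _ ljE).1.
  by have := crops (Ordinal ltj); rewrite !ffunE.
case: (posnP j) => [j0|j_gt0]; first by rewrite (act01 _ j0) (act02 _ j0).
have ltj : (j.-1 < me_past D)%N by rewrite (leq_ltn_trans (leq_pred j)).
have jE : j = (Ordinal ltj).+1 :> nat by rewrite /= prednK.
rewrite (act1 _ _ jE) (act2 _ _ jE).
by have := effs (Ordinal ltj); rewrite !ffunE.
Qed.

Hypothesis T_indep : next_conf_cond_indep crop T.

Definition next_conf_prob (s : me_state D) (a : me_action D) (x : me_conf D) :=
  prob (T s a) [set t | cur_conf t = x].

Lemma next_conf_prob_neq s1 s2 m1 m2 e x : s1 != s2 ->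
  crop (cur_image s1) m1 = crop (cur_image s2) m2 ->
  next_conf_prob s1 (m1, e) x = next_conf_prob s2 (m2, e) x.
Proof.
move=> s12 cropE; pose p1 := (s1, m1); pose p2 := (s2, m2).
have p12 : p1 != p2 by apply: contra s12 => /eqP [-> _].
pose q (p : me_state D * me_base D) E := fine (prob (T p.1 (p.2, e)) E).
have qE p E : (q p E)%:E = prob (T p.1 (p.2, e)) E.
  by rewrite fineK ?prob_fin_num//; exact: transition_pmf.
have qT p : q p setT = 1 by rewrite /q (transition_pmf T _ _).2.
have q0 p : q p set0 = 0 by rewrite /q /prob esum_set0.
(* Doubling the sum gives the finite number [q p E], which rules out infinite values and determines
   the half. *)
have half_q p E : \esum_(t in E) (2^-1 * T p.1 (p.2, e) t)%:E = (q p E / 2)%:E.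
  set h := (LHS).
  have h0 t : (0 <= (2^-1 * T p.1 (p.2, e) t)%:E)%E.
    by rewrite lee_fin mulr_ge0 ?invr_ge0//; exact: (transition_pmf T _ _).1.
  have : (h + h = (q p E)%:E)%E.
    rewrite qE -esumD//; apply: eq_esum => t _.
    by rewrite -EFinD -mulrDl -[2^-1]mul1r -splitr mul1r.
  case: h => // r [<-]; congr EFin.
  by rewrite mulrDl -splitr.
have stepE (E : set (me_state D * me_base D * me_state D)) E1 E2 :
    (forall t, E (p1, t) <-> E1 t) -> (forall t, E (p2, t) <-> E2 t) ->
    prob (step_law T e (two_point_pmf R p1 p2)) E = (q p1 E1 / 2 + q p2 E2 / 2)%:E.
  move=> EE1 EE2; rewrite /prob (esum_two_fibers _ p12).
  - rewrite EFinD -!half_q.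
    rewrite (_ : [set t | E (p1, t)] = E1); last by apply/predeqP.
    rewrite (_ : [set t | E (p2, t)] = E2); last by apply/predeqP.
    by congr (_ + _)%E; apply: eq_esum => t _;
      rewrite /step_law /two_point_pmf /= eqxx ?orbT.
  - move=> w; rewrite lee_fin mulr_ge0 ?two_point_pmf_ge0//.
    exact: (transition_pmf T _ _).1.
  - by move=> w /negbTE w1 /negbTE w2;
      rewrite /step_law /two_point_pmf w1 w2 mul0r.
have s21 : s2 <> s1 by move=> s21; rewrite s21 eqxx in s12.
(* Both pairs show this crop, so the conditioning event has probability 1, while the event that the
   state is [s1] selects [p1] alone. With [q1], [q2] the two probabilities of [x], independence
   reads [q1/2 * 1 = (q1/2 + q2/2) * 1/2], so [q1 = q2]. *)
have := T_indep e (is_pmf_two_point R p12) x s1 (crop (cur_image s1) m1).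
rewrite (stepE _ [set t | cur_conf t = x] set0); [|by split=> [[]|]|by split=> [[]|]].
rewrite (stepE _ setT setT); [|by split|by split].
rewrite (stepE _ [set t | cur_conf t = x] [set t | cur_conf t = x]);
  [|by split=> [[]|]|by split=> [[]|]].
rewrite (stepE _ setT set0); [|by split|by split=> [[]|]].
rewrite !qT !q0 -!EFinM => -[eq_q].
rewrite /next_conf_prob -[LHS](qE p1) -[RHS](qE p2); congr EFin.
have half0 : 2^-1 != 0 :> R by rewrite invr_eq0 pnatr_eq0.
move: eq_q; rewrite !mul0r !addr0 -splitr mulr1 -mulrDl mul1r => /(mulIf half0).
by rewrite mulrDl {1}[q p1 _]splitr => /addrI/(mulIf half0).
Qed.

Lemma next_conf_prob_crop s1 s2 m1 m2 e x :
  crop (cur_image s1) m1 = crop (cur_image s2) m2 ->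
  next_conf_prob s1 (m1, e) x = next_conf_prob s2 (m2, e) x.
Proof.
move=> cropE; have [s12|] := eqVneq s1 s2; last first.
  by move=> s12; exact: next_conf_prob_neq.
have [[c cNx]|noc] := pselect (exists c, c <> cur_conf s1).
  (* The hypothesis says nothing about two actions available in the same state,
     so they are compared through a third state that shows the same image. *)
  pose s3 : me_state D := (images s1, [ffun=> c], actions s1).
  have s13 : s1 != s3.
    by apply/eqP => s13; apply: cNx; rewrite s13 /cur_conf ffunE.
  rewrite (@next_conf_prob_neq _ s3 _ m1)//.
  by apply: next_conf_prob_neq => //; rewrite -s12 eq_sym.
(* Here the configuration space is a single point, so both probabilities equal 1. *)
have allx (s : me_state D) : cur_conf s = x.
  have all1 c : c = cur_conf s1 by apply: contrapT => ?; apply: noc; exists c.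
  by rewrite (all1 x) (all1 (cur_conf s)).
rewrite /next_conf_prob (_ : [set t | _] = setT).
  by rewrite !(transition_pmf T _ _).2.
by apply/seteqP; split=> t //= _; exact: allx.
Qed.

Hypothesis T_history : history_transition T.

(** On supported successors the abstract past is forced, so the mass of a fibre is either zero or
    the probability of its configuration. *)
Lemma pushforward_deictic s1 s2 a1 a2 u :
  f s1 = f s2 -> g s1 a1 = g s2 a2 ->
  prob (T s1 a1) [set t | f t = u] = prob (T s2 a2) [set t | f t = u].
Proof.
move=> fE gE; have [[t0 [ft0 supp]]|nosupp] :=
  pselect (exists t0, f t0 = u /\ (T s1 a1 t0 != 0 \/ T s2 a2 t0 != 0)).
  have fiberE s a : f s = f s1 -> g s a = g s1 a1 ->
      prob (T s a) [set t | f t = u] = next_conf_prob s a u.2.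
    move=> fs ga; apply: eq_prob_support => t /T_history st.
    have ft : (f t).1 = u.1.
      rewrite -ft0; case: supp => /T_history st0.
        exact: successor_deictic_state st st0.
      by apply: successor_deictic_state st st0; rewrite ?fs ?ga.
    split=> /= [<-//|tu]; have {tu} : (f t).2 = u.2 by [].
    by move: ft; case: (f t) => ? ? /= -> ->; rewrite -surjective_pairing.
  rewrite !fiberE//; case: a1 a2 gE {supp fiberE} => [m1 e1] [m2 e2] [cropE ->].
  exact: next_conf_prob_crop.
rewrite !(@eq_prob_support _ _ _ [set t | f t = u] set0).
- by rewrite /prob !esum_set0.
- by move=> t st; split=> // ft; apply: nosupp; exists t; split=> //; right.
- by move=> t st; split=> // ft; apply: nosupp; exists t; split=> //; left.
Qed.

End DeicticHomomorphism.

Theorem theorem2 (R : realType) (D : me_spaces R)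
    (T : transition R (me_state D) (me_action D))
    (T_history : history_transition T)
    (K : set 'cV[R]_(me_dim D)) (K_closed : closed K)
    (crop : me_image D -> me_base D -> crop_image K)
    (crop_def : is_crop crop)
    (T_indep : next_conf_cond_indep crop T)
    (Rw' : abs_state K -> abs_action K -> R) :
  exists (Rw : me_state D -> me_action D -> R)
         (T' : transition R (abs_state K) (abs_action K)),
    @mdp_homomorphism R (MDP T Rw) (MDP T' Rw')
      (deictic_state crop) (deictic_action crop).
Proof.
pose lifts u b (sa : me_state D * me_action D) :=
  deictic_state crop sa.1 = u /\ deictic_action crop sa.1 sa.2 = b.
(* [T'] is built from one chosen lift [sa'] of each abstract pair; independence of this choice is
   only invoked at the end, through [pushforward_deictic]. *)
have [T' T'E] : exists T' : transition R (abs_state K) (abs_action K),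
    forall u b sa, lifts u b sa -> exists2 sa', lifts u b sa' &
      T' u b = pushforward_pmf (deictic_state crop) (T sa'.1 sa'.2) :> (_ -> _).
  have pmfE u b : exists2 P : abs_state K -> R, is_pmf P &
      forall sa, lifts u b sa -> exists2 sa', lifts u b sa' &
        P = pushforward_pmf (deictic_state crop) (T sa'.1 sa'.2).
    have [[sa lsa]|nolift] := pselect (exists sa, lifts u b sa).
      exists (pushforward_pmf (deictic_state crop) (T sa.1 sa.2)).
        exact/is_pmf_pushforward/transition_pmf.
      by move=> _ _; exists sa.
    (* The homomorphism equations do not constrain an abstract pair without lifts; any pmf will do,
       here the Dirac mass at [u]. *)
    exists (fun v => (v == u)%:R); first exact: is_pmf_dirac.
    by move=> sa lsa; case: nolift; exists sa.
  pose P u b := sval (cid2 (pmfE u b)).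
  have Ppmf u b : is_pmf (P u b) by rewrite /P; case: cid2.
  exists (Transition Ppmf) => u b sa /=.
  by rewrite /P; case: cid2 => /= Q _; apply.
(* Pulling [Rw'] back along the mapping makes the reward equation hold by definition. *)
exists (fun s a => Rw' (deictic_state crop s) (deictic_action crop s a)), T'.
move=> s a u; split=> //=.
have [[s' a'] [/= fE gE] ->] := T'E _ _ (s, a) (conj erefl erefl).
rewrite pushforward_pmfE; last exact: transition_pmf.
exact: pushforward_deictic.
Qed.
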